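(* Let $H=(H_i)_{i\in\mathbb I}$ be a family of continuous Hamiltonians on $\mathbb T^n\times\mathbb R^n\times\mathbb R^m$ that is coercive, convex and monotone, and assume that the system $(P_0)$, that is, $H_i(x,Du_i(x),u(x))=0$ in $\mathbb T^n$ for $i\in\mathbb I$, has a solution in $C(\mathbb T^n)^m$. For $\lambda>0$ let $v^\lambda$ be the solution of $(P_\lambda)$: $\lambda v_i^\lambda(x)+H_i(x,Dv_i^\lambda(x),v^\lambda(x))=0$ in $\mathbb T^n$, $i\in\mathbb I$. Then there exists a solution $v^0$ of $(P_0)$ such that the functions $v^\lambda$ converge to $v^0$ in $C(\mathbb T^n)^m$ as $\lambda\to 0+$.
   Context: $n,m\in\mathbb N$; $\mathbb T^n$ is the $n$-dimensional flat torus; $\mathbb I=\{1,\dots,m\}$; $H_i:\mathbb T^n\times\mathbb R^n\times\mathbb R^m\to\mathbb R$ is continuous for each $i\in\mathbb I$; $B_R^m$ is the open ball in $\mathbb R^m$ with center at the origin and radius $R$. For $\lambda\ge 0$, $(P_\lambda)$ is the system $\lambda v_i(x)+H_i(x,Dv_i(x),v(x))=0$ in $\mathbb T^n$, $i\in\mathbb I$, for an unknown $v=(v_i)_{i\in\mathbb I}:\mathbb T^n\to\mathbb R^m$. Solutions are in the viscosity sense: an upper (resp. lower) semicontinuous $v$ is a subsolution (resp. supersolution) if whenever $i\in\mathbb I$, $\varphi\in C^1(\mathbb T^n)$ and $v_i-\varphi$ has a maximum (resp. minimum) at $x$, then $\lambda v_i(x)+H_i(x,D\varphi(x),v(x))\le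 0$ (resp. $\ge 0$); a continuous solution is both. Coercive: for any $i\in\mathbb I$ and $R>0$, $\lim_{|p|\to\infty}\inf_{(x,u)\in\mathbb T^n\times B_R^m}H_i(x,p,u)=\infty$. Convex: for any $(x,i)\in\mathbb T^n\times\mathbb I$, $(p,u)\mapsto H_i(x,p,u)$ is convex on $\mathbb R^n\times\mathbb R^m$. Monotone: for any $(x,p)\in\mathbb T^n\times\mathbb R^n$ and $u,v\in\mathbb R^m$, if $u_k-v_k=\max_{i\in\mathbb I}(u_i-v_i)\ge 0$, then $H_k(x,p,u)\ge H_k(x,p,v)$. It is well known that if $H$ is coercive and monotone and $\lambda>0$, then $(P_\lambda)$ has a unique continuous solution $v^\lambda$, and it is Lipschitz continuous; this is the meaning of ''the solution of $(P_\lambda)$''. *)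

(* Defs.v *)
From HB Require Import structures.
From mathcomp Require Import all_boot all_order all_algebra.
From mathcomp Require Import all_classical all_reals all_analysis.

Set Implicit Arguments.
Unset Strict Implicit.
Unset Printing Implicit Defensive.

Import Order.TTheory GRing.Theory Num.Theory.
Import numFieldNormedType.Exports.

Local Open Scope classical_set_scope.
Local Open Scope ring_scope.

(* The flat torus T^n is R^n / Z^n: functions on T^n are the Z^n-periodic
   functions on R^n, C(T^n) is the set of the continuous ones, and a maximum
   over T^n is a maximum over R^n. *)
Definition torus_fun (R : realType) (n : nat) (V : Type)
    (f : 'rV[R]_n -> V) : Prop :=
  forall (x : 'rV[R]_n) (k : 'rV[int]_n),
    f (x + map_mx (fun z : int => z%:~R) k) = f x.

(* The library norm on row vectors is the sup norm. *)
Definition enorm (R : realType) (d : nat) (p : 'rV[R]_d) : R :=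
  Num.sqrt (\sum_(j < d) p 0 j ^+ 2).

Definition grad (R : realType) (n : nat) (phi : 'rV[R]_n -> R)
    (x : 'rV[R]_n) : 'rV[R]_n :=
  \row_(j < n) 'D_(delta_mx 0 j) phi x.

Definition torus_C1 (R : realType) (n : nat) (phi : 'rV[R]_n -> R) : Prop :=
  [/\ torus_fun phi, forall x, differentiable phi x & continuous (grad phi)].

Definition lsc (R : realType) (n : nat) (f : 'rV[R]_n -> R) : Prop :=
  lower_semicontinuous (fun x => (f x)%:E).

Definition usc (R : realType) (n : nat) (f : 'rV[R]_n -> R) : Prop :=
  lsc (fun x => - f x).

(* H i x p u stands for H_i(x, p, u). *)
Definition hamiltonians (R : realType) (n m : nat) : Type :=
  'I_m -> 'rV[R]_n -> 'rV[R]_n -> 'rV[R]_m -> R.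

Definition torus_hamiltonians (R : realType) (n m : nat)
    (H : hamiltonians R n m) : Prop :=
  forall i p u, torus_fun (fun x => H i x p u).

Definition continuous_hamiltonians (R : realType) (n m : nat)
    (H : hamiltonians R n m) : Prop :=
  forall i, continuous (fun z : 'rV[R]_n * 'rV[R]_n * 'rV[R]_m =>
    H i z.1.1 z.1.2 z.2).

Definition coercive (R : realType) (n m : nat)
    (H : hamiltonians R n m) : Prop :=
  forall (i : 'I_m) (r : R), 0 < r ->
  forall M : R, exists K : R, forall p : 'rV[R]_n, K < enorm p ->
    (M%:E <= ereal_inf [set (H i xu.1 p xu.2)%:E |
                          xu in [set xu : 'rV[R]_n * 'rV[R]_m |
                                   (enorm xu.2 < r)%R]])%E.

Definition convex_hamiltonians (R : realType) (n m : nat)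
    (H : hamiltonians R n m) : Prop :=
  forall (i : 'I_m) (x : 'rV[R]_n),
    convex_function [set: 'rV[R]_n * 'rV[R]_m]
      (fun pu : 'rV[R]_n * 'rV[R]_m => H i x pu.1 pu.2).

Definition monotone_hamiltonians (R : realType) (n m : nat)
    (H : hamiltonians R n m) : Prop :=
  forall (x p : 'rV[R]_n) (u w : 'rV[R]_m) (k : 'I_m),
    (forall i : 'I_m, u 0 i - w 0 i <= u 0 k - w 0 k) ->
    0 <= u 0 k - w 0 k ->
    H k x p w <= H k x p u.

(* (P_lambda): lambda v_i + H_i(x, D v_i, v) = 0 on T^n for all i, where the
   component v_i(x) is v x 0 i. *)
Definition viscosity_subsolution (R : realType) (n m : nat)
    (H : hamiltonians R n m) (lambda : R) (v : 'rV[R]_n -> 'rV[R]_m) : Prop :=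
  [/\ torus_fun v,
      forall i : 'I_m, usc (fun x => v x 0 i)
    & forall (i : 'I_m) (phi : 'rV[R]_n -> R) (x : 'rV[R]_n),
        torus_C1 phi ->
        (forall y, v y 0 i - phi y <= v x 0 i - phi x) ->
        lambda * v x 0 i + H i x (grad phi x) (v x) <= 0].

Definition viscosity_supersolution (R : realType) (n m : nat)
    (H : hamiltonians R n m) (lambda : R) (v : 'rV[R]_n -> 'rV[R]_m) : Prop :=
  [/\ torus_fun v,
      forall i : 'I_m, lsc (fun x => v x 0 i)
    & forall (i : 'I_m) (phi : 'rV[R]_n -> R) (x : 'rV[R]_n),
        torus_C1 phi ->
        (forall y, v x 0 i - phi x <= v y 0 i - phi y) ->
        0 <= lambda * v x 0 i + H i x (grad phi x) (v x)].

Definition viscosity_solution (R : realType) (n m : nat)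
    (H : hamiltonians R n m) (lambda : R) (v : 'rV[R]_n -> 'rV[R]_m) : Prop :=
  [/\ continuous v,
      viscosity_subsolution H lambda v
    & viscosity_supersolution H lambda v].

(* Main.v *)
Require Import Defs.
From mathcomp Require Import all_boot all_order all_algebra.
From mathcomp Require Import all_classical all_reals all_analysis.
From mathcomp Require Import ring lra.

(** Write v^d for the solution of (P_d).  The proof compares v^l with convex
    combinations of v^d and a limit point w of the family as the discount
    tends to zero.

    Suppose that w solves (P_0) and |v^d - w| <= e for some d.  For 0 < l < d
    put a = l / d and z = a v^d + (1 - a) w.  By convexity of H in (p, u), z is
    a subsolution of H_i(x, Dz, z) <= - a d v^d_i, so that
    l z_i + H_i(x, Dz, z) <= l (z_i - v^d_i) = l (1 - a) (w_i - v^d_i) <= l e.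
    The comparison principle for (P_l) then gives z <= v^l + e.  Here d is
    fixed; when l tends to zero, a tends to zero and z to w, hence
    w <= liminf v^l + e ([limit_points_le]).  So any limit point lies below any
    other one, and all limit points agree.  Together with compactness of the
    family v^l this gives the convergence.

    Comparison and convexity are used together, without ever showing that z is
    a viscosity subsolution.  Tripling the variables, one maximizes
    a u1_i(x) + b u2_i(y) - w_i(s) - k (a S(x - s) + b S(y - s)) with a smooth
    periodic penalty S vanishing exactly on the lattice.  With a + b = 1 the
    slope seen by the supersolution w is exactly the convex combination
    a p1 + b p2 of the slopes seen by u1 and u2.  Coercivity bounds p1 and p2
    uniformly in k, so that k can be sent to infinity, which leaves a point s,
    an index i and slopes p1, p2 at which all three inequalities hold and where
    a u1 + b u2 - w is maximal ([nonsmooth_max_principle]).  Convexity and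
    monotonicity are then applied at that single point
    ([convex_comparison]).

    Compactness comes from the same comparison, which bounds v^l by a solution
    of (P_0) ([discounted_bound]), and from coercivity, which gives a modulus
    of continuity uniform in l ([subsolution_modulus]).  Limits are taken along
    ultrafilters, which replaces the extraction of subsequences; limits are
    solutions by the usual stability argument ([solution_uniform_limit]). *)

Set Implicit Arguments.
Unset Strict Implicit.
Unset Printing Implicit Defensive.

Import Order.TTheory GRing.Theory Num.Theory.
Import numFieldNormedType.Exports.
Local Open Scope classical_set_scope.
Local Open Scope ring_scope.

(** * Calculus of continuously differentiable functions *)

(** Carrying the gradient as an explicit function lets the rules of calculus
    below compute it together with the proof of regularity. *)
Definition C1_with_grad (R : realType) (n : nat)
    (phi : 'rV[R]_n -> R) (g : 'rV[R]_n -> 'rV[R]_n) :=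
  [/\ forall x, differentiable phi x, forall x, grad phi x = g x
    & continuous g].

Lemma C1_cst (R : realType) (n : nat) (c : R) :
  C1_with_grad (fun=> c) (fun=> 0 : 'rV[R]_n).
Proof.
split=> [x|x|x]; first exact: differentiable_cst.
- by apply/rowP => j; rewrite !mxE derive_cst.
- exact: cst_continuous.
Qed.

Lemma C1_add (R : realType) (n : nat) (phi psi : 'rV[R]_n -> R) g h :
  C1_with_grad phi g -> C1_with_grad psi h ->
  C1_with_grad (fun x => phi x + psi x) (fun x => g x + h x).
Proof.
move=> [dphi gE gc] [dpsi hE hc]; split=> [x|x|x].
- exact: differentiableD.
- rewrite -gE -hE; apply/rowP => j; rewrite !mxE.
  by apply: deriveD; apply: diff_derivable.
- by apply: continuousD; [exact: gc|exact: hc].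
Qed.

Lemma C1_sum (R : realType) (n k : nat) (phi : 'I_k -> 'rV[R]_n -> R) g :
  (forall j, C1_with_grad (phi j) (g j)) ->
  C1_with_grad (fun x => \sum_(j < k) phi j x) (fun x => \sum_(j < k) g j x).
Proof.
elim: k phi g => [|k IH] phi g phig.
  have := C1_cst n (0 : R); congr C1_with_grad.
    by apply/funext => x; rewrite big_ord0.
  by apply/funext => x; rewrite big_ord0.
have := C1_add (IH _ _ (fun j => phig (widen_ord (leqnSn k) j))) (phig ord_max).
by congr C1_with_grad; apply/funext => x; rewrite big_ord_recr.
Qed.

Lemma C1_comp (R : realType) (n : nat) (phi : 'rV[R]_n -> R) g (f f' : R -> R) :
  (forall x, is_derive (phi x) 1 f (f' (phi x))) ->
  continuous (fun x => f' (phi x)) ->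
  C1_with_grad phi g ->
  C1_with_grad (fun x => f (phi x)) (fun x => f' (phi x) *: g x).
Proof.
move=> df cf' [dphi gE gc].
have df1 x : differentiable f (phi x).
  by apply/derivable1_diffP; have [] := df x.
split=> [x|x|x]; first exact: differentiable_comp.
- rewrite -gE; apply/rowP => j; rewrite !mxE.
  rewrite deriveE; last exact: differentiable_comp.
  rewrite (_ : (fun x => f (phi x)) = f \o phi)// diff_comp//=.
  rewrite deriveE// -[X in 'd f _ X]mulr1.
  rewrite -[X in 'd f _ X]/(_ *: (1 : R)) linearZ/=.
  by rewrite -[X in _ *: X]deriveE// derive_val mulrC.
- by apply: continuousZ; [exact: cf'|exact: gc].
Qed.

Lemma C1_scale (R : realType) (n : nat) (c : R) (phi : 'rV[R]_n -> R) g :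
  C1_with_grad phi g ->
  C1_with_grad (fun x => c * phi x) (fun x => c *: g x).
Proof.
move=> phig.
apply: (@C1_comp _ _ _ _ (fun t => c * t) (fun=> c)) => //.
  by move=> x; apply: is_derive_eq; rewrite /GRing.scale/= mulr1.
by move=> x; exact: cst_continuous.
Qed.

(** A directional derivative only sees the values along translates of the base
    point; this yields both the invariance of [C1_with_grad] under shifts and
    the periodicity of gradients. *)
Lemma derive_translate (R : realType) (n : nat) (phi psi : 'rV[R]_n -> R)
    (v x y : 'rV[R]_n) :
  (forall z, phi (z + x) = psi (z + y)) -> 'D_v phi x = 'D_v psi y.
Proof.
move=> E; rewrite /derive.
apply: (congr1 (fun f : R -> R^o => lim (f h @[h --> 0^']))).
by apply/funext => h /=; rewrite E -(add0r x) E add0r.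
Qed.

Lemma C1_shift (R : realType) (n : nat) (s : 'rV[R]_n) (phi : 'rV[R]_n -> R) g :
  C1_with_grad phi g ->
  C1_with_grad (fun x => phi (x - s)) (fun x => g (x - s)).
Proof.
move=> [dphi gE gc].
have ds x : is_diff x (fun y : 'rV[R]_n => y - s) id.
  apply: is_diff_eq; exact: subr0.
have dd x : differentiable (fun x => phi (x - s)) x.
  by apply: (@differentiable_comp _ _ _ _ (fun y => y - s)).
split=> [//|x|x].
- rewrite -gE; apply/rowP => j; rewrite !mxE.
  by apply: derive_translate => z; rewrite addrA.
- have cs : {for x, continuous (fun y : 'rV[R]_n => y - s)}.
    by apply: continuousB; [exact: cvg_id|exact: cst_continuous].
  exact: (continuous_comp cs (gc _)).
Qed.

Lemma C1_coord (R : realType) (n : nat) (j : 'I_n) :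
  C1_with_grad (fun x : 'rV[R]_n => x 0 j) (fun=> delta_mx 0 j).
Proof.
split=> [x|x|x]; first exact: differentiable_coord.
- apply/rowP => k; rewrite [LHS]mxE /derive.
  apply/cvg_lim => //.
  have -> : (delta_mx 0 j : 'rV[R]_n) 0 k = (delta_mx 0 k : 'rV[R]_n) 0 j.
    by rewrite !mxE !eqxx eq_sym.
  apply: cvg_near_cst; near=> h.
  rewrite /shift/= mxE addrK mxE /GRing.scale/= mulrA mulVf ?mul1r//.
  by near: h; exact: nbhs_dnbhs_neq.
- exact: cst_continuous.
Unshelve. all: end_near. Qed.

(** * The periodic penalty *)

Local Notation lattice k := (map_mx (fun z : int => z%:~R) k).

Lemma torus_fun_shift (R : realType) (n : nat) (V : Type) (f : 'rV[R]_n -> V) s :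
  torus_fun f -> torus_fun (fun x => f (x - s)).
Proof. by move=> fT x k; rewrite addrAC fT. Qed.

Lemma torus_funB (R : realType) (n : nat) (V : Type) (f : 'rV[R]_n -> V) :
  torus_fun f -> forall x k, f (x - lattice k) = f x.
Proof.
move=> fT x k; rewrite -[RHS](fT _ (- k)); congr (f (_ + _)).
by apply/rowP => j; rewrite !mxE rmorphN.
Qed.

Lemma grad_torus (R : realType) (n : nat) (phi : 'rV[R]_n -> R) :
  torus_fun phi -> torus_fun (grad phi).
Proof.
move=> phiT x k; apply/rowP => j; rewrite !mxE.
by apply: derive_translate => z; rewrite addrA phiT.
Qed.

Lemma torus_C1_from_grad (R : realType) (n : nat) (phi : 'rV[R]_n -> R) g :
  torus_fun phi -> C1_with_grad phi g -> torus_C1 phi.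
Proof.
by move=> ? [? /funext E ?]; split=> //; rewrite E.
Qed.

Lemma torus_C1_with_grad (R : realType) (n : nat) (phi : 'rV[R]_n -> R) :
  torus_C1 phi -> C1_with_grad phi (grad phi).
Proof. by case. Qed.

(** This is the smooth periodic substitute for the squared distance on the
    torus: test functions must be periodic, which excludes the square of the
    norm itself. *)
Definition torus_gap (R : realType) (n : nat) (t : 'rV[R]_n) : R :=
  \sum_(j < n) sin (pi * t 0 j) ^+ 2.

Definition grad_gap (R : realType) (n : nat) (t : 'rV[R]_n) : 'rV[R]_n :=
  \row_(j < n) (2 * pi * sin (pi * t 0 j) * cos (pi * t 0 j)).

Lemma sqr_sin_pi_int (R : realType) (z : int) (a : R) :
  sin (pi * (a + z%:~R)) ^+ 2 = sin (pi * a) ^+ 2.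
Proof.
elim: z a => [|k IH|k IH] a; first by rewrite addr0.
- by rewrite intS rmorphD/= addrCA addrC mulrDr mulr1 sinDpi sqrrN.
- rewrite -addn1 PoszD opprD rmorphD/= addrA -(IH a) rmorphN/=.
  have := sinDpi (pi * (a + - k%:~R + - 1) : R).
  rewrite -[X in _ + X]mulr1 -mulrDr subrK => ->.
  by rewrite sqrrN mulrN1z.
Qed.

Lemma gap_torus (R : realType) (n : nat) : torus_fun (@torus_gap R n).
Proof.
by move=> x k; apply: eq_bigr => j _; rewrite !mxE sqr_sin_pi_int.
Qed.

Lemma gap_ge0 (R : realType) (n : nat) (t : 'rV[R]_n) : 0 <= torus_gap t.
Proof. by apply: sumr_ge0 => j _; exact: sqr_ge0. Qed.

Lemma gap0 (R : realType) (n : nat) : torus_gap (0 : 'rV[R]_n) = 0.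
Proof. by apply: big1 => j _; rewrite mxE mulr0 sin0 expr0n. Qed.

Lemma gapN (R : realType) (n : nat) (t : 'rV[R]_n) :
  torus_gap (- t) = torus_gap t.
Proof. by apply: eq_bigr => j _; rewrite mxE mulrN sinN sqrrN. Qed.

Lemma grad_gapN (R : realType) (n : nat) (t : 'rV[R]_n) :
  grad_gap (- t) = - grad_gap t.
Proof. by apply/rowP => j; rewrite !mxE mulrN sinN cosN; ring. Qed.

Lemma gap_eq0 (R : realType) (n : nat) (t : 'rV[R]_n) : torus_gap t = 0 ->
  exists k : 'rV[int]_n, t = lattice k.
Proof.
move=> /psumr_eq0P gt0.
exists (\row_j Num.floor (t 0 j)); apply/rowP => j; rewrite !mxE.
set z := Num.floor _; apply/eqP; rewrite -subr_eq0 eq_le.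
have r0 : 0 <= t 0 j - z%:~R by rewrite subr_ge0 floor_le_tmp.
rewrite r0 andbT leNgt; apply/negP => r0'.
have : sin (pi * (t 0 j - z%:~R)) ^+ 2 = 0.
  by rewrite -rmorphN/= sqr_sin_pi_int gt0// => i _; exact: sqr_ge0.
apply/eqP; rewrite expf_eq0/= gt_eqF// sin_gt0_pi//.
have pi0 := @pi_gt0 R.
rewrite mulr_gt0//= gtr_pMr// ltrBlDl.
have := floorD1_gt (t 0 j); rewrite rmorphD/=; lra.
Qed.

Lemma gap_C1 (R : realType) (n : nat) : C1_with_grad (@torus_gap R n) (@grad_gap R n).
Proof.
have cs (x : R) : {for x, continuous (fun x : R => sin (pi * x))}.
  apply: (@continuous_comp _ _ _ (fun x => pi * x)); last exact: continuous_sin.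
  by apply: mulrl_continuous.
have cc (x : R) : {for x, continuous (fun x : R => cos (pi * x))}.
  apply: (@continuous_comp _ _ _ (fun x => pi * x)); last exact: continuous_cos.
  by apply: mulrl_continuous.
have := @C1_sum R n n (fun j x => sin (pi * x 0 j) ^+ 2)
  (fun j x => (2 * pi * sin (pi * x 0 j) * cos (pi * x 0 j)) *: delta_mx 0 j).
have -> : (fun x : 'rV[R]_n => \sum_(j < n) (2 * pi * sin (pi * x 0 j) *
   cos (pi * x 0 j)) *: delta_mx 0 j) = @grad_gap R n.
  apply/funext => x; apply/rowP => j; rewrite summxE (bigD1 j)//= big1 => [|i ij].
    by rewrite !mxE !eqxx mulr1 addr0.
  by rewrite !mxE [j == i]eq_sym (negbTE ij) andbF mulr0.
apply=> j.
apply: (@C1_comp _ _ _ _ (fun t : R => sin (pi * t) ^+ 2)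
  (fun t => 2 * pi * sin (pi * t) * cos (pi * t))); last exact: C1_coord.
- move=> x; pose f (t : R) := sin (pi * t).
  have df : is_derive (x 0 j) 1 f (pi * cos (pi * x 0 j)).
    rewrite (_ : f = sin \o (fun t => pi * t))//.
    by apply: is_derive_eq; rewrite /GRing.scale/= mulr1 mulrC.
  rewrite (_ : (fun t => _) = f ^+ 2)//.
  by apply: is_derive_eq; rewrite /GRing.scale/= /f expr1; ring.
- move=> x; apply: (@continuous_comp _ _ _ (fun x : 'rV[R]_n => x 0 j)
    (fun t => 2 * pi * sin (pi * t) * cos (pi * t))); first exact: coord_continuous.
  apply: continuousM; last exact: cc.
  by apply: continuousM; [exact: cst_continuous|exact: cs].
Qed.

Lemma gap_continuous (R : realType) (n : nat) : continuous (@torus_gap R n).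
Proof. by move=> x; apply: differentiable_continuous; case: (@gap_C1 R n). Qed.

(** Near the lattice the gradient is at least of the order of the square root of
    the gap, as for a squared distance.  The bound on the gap keeps every cosine
    away from zero, that is, away from the other critical points. *)
Lemma grad_gap_lower (R : realType) (n : nat) (t : 'rV[R]_n) :
  torus_gap t <= 2^-1 -> 8 * torus_gap t <= enorm (grad_gap t) ^+ 2.
Proof.
move=> gt2; rewrite sqr_sqrtr; last by apply: sumr_ge0 => j _; exact: sqr_ge0.
rewrite mulr_sumr; apply: ler_sum => j _; rewrite !mxE.
have sj : sin (pi * t 0 j) ^+ 2 <= 2^-1.
  apply: le_trans gt2; rewrite /torus_gap (bigD1 j)//= lerDl.
  by apply: sumr_ge0 => i _; exact: sqr_ge0.
have := cos2Dsin2 (pi * t 0 j); have := @pi_ge2 R.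
move: sj; set s := sin _; set c := cos _ => s2 p2 cs.
have p4 : 4 <= (pi : R) ^+ 2 by nra.
have c2 : 2^-1 <= c ^+ 2 by lra.
have s0 := sqr_ge0 s.
rewrite [leRHS](_ : _ = 4 * (pi ^+ 2 * c ^+ 2) * s ^+ 2); last by ring.
by apply: ler_wpM2r => //; nra.
Qed.

(** * Compactness along ultrafilters *)

Lemma ultra_fmap (T U : Type) (f : T -> U) (G : set_system T) :
  UltraFilter G -> UltraFilter (f @ G).
Proof.
move=> GU; split; first exact: fmap_proper_filter.
move=> K KP GK; apply/seteqP; split=> [A KA|]; last exact: GK.
have [//|GnA] := in_ultra_setVsetC (f @^-1` A) GU.
have /GK KnA : (f @ G) (~` A) by [].
have : K set0 by rewrite -(setICr A); exact: filterI.
by move=> /(@filter_not_empty _ _ KP).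
Qed.

Lemma ultra_compact_cvg (T : Type) (U : topologicalType) (f : T -> U)
    (G : set_system T) (A : set U) :
  UltraFilter G -> compact A -> (\forall t \near G, A (f t)) ->
  exists2 l, A l & f @ G --> l.
Proof.
move=> GU; rewrite compact_ultra => cA GA.
by have [l [Al fl]] := cA _ (ultra_fmap f GU) GA; exists l.
Qed.

Lemma ultra_finite (T : Type) (I : finType) (G : set_system T) (f : T -> I) :
  UltraFilter G -> exists i, \forall t \near G, f t = i.
Proof.
move=> GU; apply: contrapT => /forallNP nG.
have /filter_forall H i : \forall t \near G, f t <> i.
  by have [/nG//|] := in_ultra_setVsetC [set t | f t = i] GU.
have [t] := filter_ex H; exact.
Qed.

Definition unit_cube (R : realType) (n : nat) : set 'rV[R]_n :=
  [set x | forall j, `[0, 1]%classic (x 0 j)].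

Lemma unit_cube_compact (R : realType) (n : nat) : compact (@unit_cube R n).
Proof.
exact: (@rV_compact R n (fun=> `[0, 1]%classic) (fun=> @segment_compact R 0 1)).
Qed.

Lemma unit_cube_repr (R : realType) (n : nat) (x : 'rV[R]_n) :
  exists k, unit_cube (x + lattice k).
Proof.
exists (\row_j - Num.floor (x 0 j)) => j.
rewrite !mxE rmorphN/= in_itv/= subr_ge0 floor_le_tmp lerBlDl/=.
by have /ltW := floorD1_gt (x 0 j); rewrite rmorphD.
Qed.

(** Periodicity reduces a maximum over the whole space to one over a compact
    product of unit cubes. *)
Lemma torus_max3 (R : realType) (n : nat)
    (f : 'rV[R]_n * 'rV[R]_n * 'rV[R]_n -> R) : continuous f ->
  (forall y s, torus_fun (fun x => f (x, y, s))) ->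
  (forall x s, torus_fun (fun y => f (x, y, s))) ->
  (forall x y, torus_fun (fun s => f (x, y, s))) ->
  exists z, [/\ unit_cube z.1.1, unit_cube z.1.2, unit_cube z.2
    & forall z', f z' <= f z].
Proof.
move=> cf f1 f2 f3.
have cC := @unit_cube_compact R n.
have c0 : @unit_cube R n 0 by move=> j; rewrite mxE /= in_itv/= lexx ler01.
have C0 : (@unit_cube R n `*` @unit_cube R n) `*` @unit_cube R n !=set0.
  by exists (0, 0, 0).
have [[[x y] s] /set_mem/= [[Cx Cy] Cs] fmax] :=
  compact_EVT_max C0 (compact_setX (compact_setX cC cC) cC)
    (continuous_subspaceT cf).
exists (x, y, s); split=> // -[[x' y'] s'].
have [k Ck] := unit_cube_repr x'.
have [k2 C2] := unit_cube_repr y'.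
have [k3 C3] := unit_cube_repr s'.
rewrite -(f1 _ _ x' k) -(f2 _ _ y' k2) -(f3 _ _ s' k3).
by apply: fmax; apply/mem_set.
Qed.

Lemma torus_max (R : realType) (n : nat) (f : 'rV[R]_n -> R) : continuous f ->
  torus_fun f -> exists2 x, unit_cube x & forall y, f y <= f x.
Proof.
move=> cf fT.
have [||||[[x y] s]/= [Cx _ _ fmax]] := @torus_max3 R n (fun z => f z.1.1) => //.
  move=> z; apply: (@continuous_comp _ _ _ (fun z => z.1.1)); last exact: cf.
  by apply: (@continuous_comp _ _ _ fst fst); exact: cvg_fst.
by exists x => // z; exact: (fmax (z, 0, 0)).
Qed.

Lemma torus_bounded (R : realType) (n m : nat) (u : 'rV[R]_n -> 'rV[R]_m) :
  continuous u -> torus_fun u -> exists2 C, 0 <= C & forall x, `|u x| <= C.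
Proof.
move=> cu uT; have [||x _ umax] := @torus_max R n (fun x => `|u x|).
- by move=> x; apply: (continuous_comp (cu x)); exact: norm_continuous.
- by move=> x k; rewrite uT.
- by exists `|u x|.
Qed.

(** * Consequences of coercivity *)

Lemma row_norm_coord (R : realType) (m : nat) (u : 'rV[R]_m) j :
  `|u 0 j| <= `|u|.
Proof.
rewrite [leRHS]/Num.norm/= mx_normrE.
exact: (le_bigmax _ (fun ij => `|u ij.1 ij.2|) (0, j)).
Qed.

Lemma row_norm_le (R : realType) (m : nat) (u : 'rV[R]_m) (c : R) : 0 <= c ->
  (forall j, `|u 0 j| <= c) -> `|u| <= c.
Proof.
move=> c0 uc; rewrite [leLHS]/Num.norm/= mx_normrE.
by apply: bigmax_le => // -[i j] _ /=; rewrite (ord1 i).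
Qed.

Lemma enorm_le (R : realType) (m : nat) (u : 'rV[R]_m) : enorm u <= m%:R * `|u|.
Proof.
have mu : 0 <= m%:R * `|u| by rewrite mulr_ge0.
rewrite -[leRHS](ger0_norm mu) -sqrtr_sqr /enorm ler_sqrt ?sqr_ge0//.
have H : \sum_(j < m) u 0 j ^+ 2 <= m%:R * `|u| ^+ 2.
  rewrite mulr_natl -[X in _ *+ X](card_ord m) -sumr_const; apply: ler_sum => j _.
  by rewrite -real_normK ?num_real// lerXn2r ?nnegrE// row_norm_coord.
apply: le_trans H _; rewrite exprMn ler_wpM2r ?sqr_ge0//.
by rewrite -natrX ler_nat; case: (m) => // k; rewrite leq_pmulr.
Qed.

Lemma norm_le_enorm (R : realType) (m : nat) (u : 'rV[R]_m) : `|u| <= enorm u.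
Proof.
apply: row_norm_le => [|j]; first exact: sqrtr_ge0.
rewrite -sqrtr_sqr ler_sqrt; last by apply: sumr_ge0 => i _; exact: sqr_ge0.
by rewrite (bigD1 j)//= lerDl; apply: sumr_ge0 => i _; exact: sqr_ge0.
Qed.

Lemma norm_ball_compact (R : realType) (n : nat) (K : R) :
  compact [set p : 'rV[R]_n | `|p| <= K].
Proof.
apply: bounded_closed_compact.
  by exists K; split=> [|M KM p /= pK]; rewrite ?num_real// (le_trans pK)// ltW.
by apply: closed_comp (@closed_le _ K) => p _; exact: norm_continuous.
Qed.

Lemma coercive_bound (R : realType) (n m : nat) (H : hamiltonians R n m) C :
  coercive H -> exists K, forall i x p u,
    `|u| <= C -> H i x p u <= C -> `|p| <= K.
Proof.
move=> Hc.
have /choice[K HK] (i : 'I_m) : exists K, forall p, K < enorm p ->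
    forall x u, `|u| <= C -> C < H i x p u.
  have [|K HK] := Hc i (m%:R * `|C| + 1) _ (C + 1).
    by rewrite ltr_wpDl ?mulr_ge0.
  exists K => p /HK {}HK x u uC.
  have : ((C + 1)%:E <= (H i x p u)%:E)%E.
    apply: le_trans HK _; apply: ereal_inf_lbound; exists (x, u) => //=.
    apply: le_lt_trans (enorm_le u) _; rewrite ltr_pwDr// ler_wpM2l//.
    by rewrite (le_trans uC)// ler_norm.
  by rewrite lee_fin; apply: lt_le_trans; rewrite ltrDl.
exists (\sum_i `|K i|) => i x p u uC HC; apply: le_trans (norm_le_enorm p) _.
have Ki : K i <= \sum_i `|K i|.
  apply: le_trans (ler_norm _) _; rewrite (bigD1 i)//= lerDl.
  exact: sumr_ge0.
rewrite leNgt; apply/negP => /(le_lt_trans Ki)/HK/(_ x u uC).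
by rewrite ltNge HC.
Qed.

(** * Maximum principle with three points *)

Lemma hamiltonian_cvg (R : realType) (n m : nat) (H : hamiltonians R n m)
    (T : Type) (F : set_system T) {FF : Filter F}
    (X P : T -> 'rV[R]_n) (U : T -> 'rV[R]_m) i (x p : 'rV[R]_n)
    (u : 'rV[R]_m) :
  continuous_hamiltonians H -> X @ F --> x -> P @ F --> p -> U @ F --> u ->
  H i (X t) (P t) (U t) @[t --> F] --> H i x p u.
Proof.
move=> Hc Xx Pp Uu.
exact: (cvg_comp _ _ (cvg_pair (cvg_pair Xx Pp) Uu) (Hc i (x, p, u))).
Qed.

Lemma coord_cvg (R : realType) (m : nat) (T : Type) (F : set_system T)
    {FF : Filter F} (U : T -> 'rV[R]_m) (u : 'rV[R]_m) i :
  U @ F --> u -> U t 0 i @[t --> F] --> u 0 i.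
Proof.
move=> Uu; apply: (cvg_comp U (fun M : 'rV[R]_m => M 0 i) Uu).
exact: coord_continuous.
Qed.

Lemma equation_cvg (R : realType) (n m : nat) (H : hamiltonians R n m)
    (T : Type) (F : set_system T) {FF : Filter F} (c : T -> R)
    (X P : T -> 'rV[R]_n) (U : T -> 'rV[R]_m) i (c0 : R) (x p : 'rV[R]_n)
    (u : 'rV[R]_m) :
  continuous_hamiltonians H -> c @ F --> c0 ->
  X @ F --> x -> P @ F --> p -> U @ F --> u ->
  c t * U t 0 i + H i (X t) (P t) (U t) @[t --> F] --> c0 * u 0 i + H i x p u.
Proof.
move=> Hc cc Xx Pp Uu; apply: cvgD; last exact: hamiltonian_cvg.
by apply: cvgM; [|exact: coord_cvg].
Qed.

Lemma subsolution_slope_bound (R : realType) (n m : nat)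
    (H : hamiltonians R n m) (delta : R) (u : 'rV[R]_n -> 'rV[R]_m) :
  coercive H -> continuous u -> torus_fun u -> exists K, forall i x p,
    delta * u x 0 i + H i x p (u x) <= 0 -> `|p| <= K.
Proof.
move=> Hc uc uT; have [C C0 uC] := torus_bounded uc uT.
have [K HK] := coercive_bound (Num.max C (`|delta| * C)) Hc.
exists K => i x p Hp; apply: (HK i x p (u x)).
  by rewrite le_max uC.
rewrite le_max; apply/orP; right.
have : `|delta * u x 0 i| <= `|delta| * C.
  by rewrite normrM ler_wpM2l// (le_trans (row_norm_coord _ _)).
rewrite ler_norml; lra.
Qed.

Section penalised_max.
Context (R : realType) (n m : nat) (H : hamiltonians R n m) (m_gt0 : (0 < m)%N).
Variables (delta gamma lambda a b : R) (u1 u2 w : 'rV[R]_n -> 'rV[R]_m).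
Hypotheses (a0 : 0 < a) (b0 : 0 < b).
Hypotheses (u1c : continuous u1) (u2c : continuous u2) (wc : continuous w).
Hypothesis u1sub : viscosity_subsolution H delta u1.
Hypothesis u2sub : viscosity_subsolution H gamma u2.
Hypothesis wsup : viscosity_supersolution H lambda w.

(** The term a S(x - s) + b S(y - s) is chosen such that, as a test function of
    s, it has the slope a p1 + b p2, where p1 and p2 are the slopes of the test
    functions in x and in y. *)
Lemma penalised_max kappa : 0 < kappa -> exists i x y s,
  let p1 := kappa *: grad_gap (x - s) in
  let p2 := kappa *: grad_gap (y - s) in
  [/\ [/\ unit_cube x, unit_cube y & unit_cube s],
      delta * u1 x 0 i + H i x p1 (u1 x) <= 0,
      gamma * u2 y 0 i + H i y p2 (u2 y) <= 0,
      0 <= lambda * w s 0 i + H i s (a *: p1 + b *: p2) (w s)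
    & forall j z, a * u1 z 0 j + b * u2 z 0 j - w z 0 j +
        kappa * (a * torus_gap (x - s) + b * torus_gap (y - s)) <=
        a * u1 x 0 i + b * u2 y 0 i - w s 0 i].
Proof.
move=> k0.
have [u1T _ u1S] := u1sub; have [u2T _ u2S] := u2sub; have [wT _ wS] := wsup.
pose f i (z : 'rV[R]_n * 'rV[R]_n * 'rV[R]_n) :=
  a * u1 z.1.1 0 i + b * u2 z.1.2 0 i - w z.2 0 i -
  kappa * (a * torus_gap (z.1.1 - z.2) + b * torus_gap (z.1.2 - z.2)).
have fcvg i (T : Type) (F : set_system T) (FF : Filter F)
    (X Y S : T -> 'rV[R]_n) (x y s : 'rV[R]_n) :
    X @ F --> x -> Y @ F --> y -> S @ F --> s ->
    f i (X t, Y t, S t) @[t --> F] --> f i (x, y, s).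
  move=> Xx Yy Ss; rewrite /f/=.
  apply: cvgB; [apply: cvgB; [apply: cvgD|]|].
  - by apply: cvgMr; apply: coord_cvg; apply: continuous_cvg Xx; exact: u1c.
  - by apply: cvgMr; apply: coord_cvg; apply: continuous_cvg Yy; exact: u2c.
  - by apply: coord_cvg; apply: continuous_cvg Ss; exact: wc.
  - apply: cvgMr; apply: cvgD; apply: cvgMr.
    + by apply: continuous_cvg; [exact: gap_continuous|exact: cvgB].
    + by apply: continuous_cvg; [exact: gap_continuous|exact: cvgB].
have fc i : continuous (f i).
  move=> z; apply: (@fcvg i _ (nbhs z) _ (fun z => z.1.1) (fun z => z.1.2) (fun z => z.2)).
  - exact: (cvg_comp _ _ cvg_fst cvg_fst).
  - exact: (cvg_comp _ _ cvg_fst cvg_snd).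
  - exact: cvg_snd.
have gT := @gap_torus R n.
have gapB (x y : 'rV[R]_n) k : torus_gap (x + lattice k - y) = torus_gap (x - y) :> R.
  exact: (torus_fun_shift y gT x k).
have gapBr (x y : 'rV[R]_n) k : torus_gap (x - (y + lattice k)) = torus_gap (x - y) :> R.
  by rewrite opprD addrA (torus_funB gT).
have /choice[z zP] i := torus_max3 (fc i)
  (fun y s x k => ltac:(by rewrite /f/= u1T gapB))
  (fun x s y k => ltac:(by rewrite /f/= u2T gapB))
  (fun x y s k => ltac:(by rewrite /f/= wT !gapBr)).
have [i _ imax] := @arg_maxP _ _ _ (Ordinal m_gt0) predT (fun i => f i (z i)) isT.
have {}imax j z' : f j z' <= f i (z i).
  by have [_ _ _ /(_ z') /le_trans] := zP j; apply; exact: imax.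
have [Cx Cy Cs _] := zP i.
move: (z i) imax Cx Cy Cs => [[x y] s]/= imax Cx Cy Cs {zP z}.
have [E1 E2] : C1_with_grad (fun t : 'rV[R]_n => kappa * torus_gap (t - s))
    (fun t => kappa *: grad_gap (t - s)) /\
    torus_fun (fun t : 'rV[R]_n => kappa * torus_gap (t - s)).
  split; first exact/C1_scale/C1_shift/gap_C1.
  by move=> t k; rewrite gapB.
have gradE := let: And3 _ E _ := E1 in E.
exists i, x, y, s; split=> //.
- rewrite -gradE; apply: u1S; first exact: torus_C1_from_grad E2 E1.
  move=> t; have := imax i (t, y, s); rewrite /f/= => L.
  by rewrite -(ler_pM2l a0); lra.
- rewrite -gradE; apply: u2S; first exact: torus_C1_from_grad E2 E1.
  move=> t; have := imax i (x, t, s); rewrite /f/= => L.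
  by rewrite -(ler_pM2l b0); lra.
- pose phi t : R := - (a * kappa) * torus_gap (t - x) +
    - (b * kappa) * torus_gap (t - y).
  have phiC : C1_with_grad phi (fun t => - (a * kappa) *: grad_gap (t - x) +
      - (b * kappa) *: grad_gap (t - y)).
    by apply: C1_add; apply/C1_scale/C1_shift/gap_C1.
  have phiT : torus_fun phi by move=> t k; rewrite /phi !gapB.
  have := wS i phi s (torus_C1_from_grad phiT phiC).
  have [_ -> _] := phiC.
  rewrite -[s - x]opprB -[s - y]opprB !grad_gapN !scaleNr !scalerN !opprK !scalerA.
  apply=> t; have := imax i (x, y, t); rewrite /f/phi/=.
  rewrite -[s - x]opprB -[s - y]opprB -[t - x]opprB -[t - y]opprB !gapN; lra.
- move=> j t; have := imax j (t, t, t); rewrite /f/= subrr gap0; lra.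
Qed.

End penalised_max.

Lemma cvg_gap0_lattice (R : realType) (n : nat) (T : Type) (F : set_system T)
    {FF : ProperFilter F} (X Y : T -> 'rV[R]_n) (x y : 'rV[R]_n) (e : T -> R) :
  X @ F --> x -> Y @ F --> y -> e @ F --> 0 ->
  (\forall t \near F, torus_gap (X t - Y t) <= e t) ->
  exists k, x = y + lattice k.
Proof.
move=> Xx Yy e0 ge.
have gl : torus_gap (X t - Y t) @[t --> F] --> torus_gap (x - y).
  by apply: continuous_cvg; [exact: gap_continuous|exact: cvgB].
have : torus_gap (x - y) = 0.
  apply/eqP; rewrite eq_le gap_ge0 andbT -subr_ge0.
  apply: (cvgr_to_ge (cvgB e0 gl)).
  by apply: filterS ge => t; rewrite subr_ge0.
by move=> /gap_eq0[k xy]; exists k; rewrite -xy addrC subrK.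
Qed.

Section max_principle.
Context (R : realType) (n m : nat) (H : hamiltonians R n m) (m_gt0 : (0 < m)%N).
Hypotheses (H_torus : torus_hamiltonians H)
  (H_cont : continuous_hamiltonians H) (H_coercive : coercive H).
Variables (delta gamma lambda a b : R) (u1 u2 w : 'rV[R]_n -> 'rV[R]_m).
Hypotheses (a0 : 0 < a) (b0 : 0 < b).
Hypotheses (u1c : continuous u1) (u2c : continuous u2) (wc : continuous w).
Hypothesis u1sub : viscosity_subsolution H delta u1.
Hypothesis u2sub : viscosity_subsolution H gamma u2.
Hypothesis wsup : viscosity_supersolution H lambda w.

(** For smooth functions, D w = a D u1 + b D u2 at a maximum of
    a u1 + b u2 - w.  The same relation between slopes survives for
    merely continuous functions, as a limit of the penalized problems: the slopes
    of the penalty stay in a ball because of coercivity, while the points x, y, s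
    are forced together since k S(x - s) and k S(y - s) stay bounded. *)
Lemma nonsmooth_max_principle : exists i s p1 p2,
  [/\ delta * u1 s 0 i + H i s p1 (u1 s) <= 0,
      gamma * u2 s 0 i + H i s p2 (u2 s) <= 0,
      0 <= lambda * w s 0 i + H i s (a *: p1 + b *: p2) (w s)
    & forall j z, a * u1 z 0 j + b * u2 z 0 j - w z 0 j <=
        a * u1 s 0 i + b * u2 s 0 i - w s 0 i].
Proof.
have [u1T _ _] := u1sub; have [u2T _ _] := u2sub; have [wT _ _] := wsup.
have [K1 HK1] := subsolution_slope_bound delta H_coercive u1c u1T.
have [K2 HK2] := subsolution_slope_bound gamma H_coercive u2c u2T.
have /choice[I /choice[X /choice[Y /choice[S HS]]]] k :=
  penalised_max m_gt0 a0 b0 u1c u2c wc u1sub u2sub wsup (ltr0Sn R k).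
have [G [GU GF]] := ultraFilterLemma (@eventually_filter).
have [i Gi] := ultra_finite I GU.
pose P k := k.+1%:R *: grad_gap (X k - S k).
pose Q k := k.+1%:R *: grad_gap (Y k - S k).
have cC := @unit_cube_compact R n.
have [x _ Xx] : exists2 x, unit_cube x & X @ G --> x.
  by apply: ultra_compact_cvg => //; apply: nearW => k; have [[]] := HS k.
have [y _ Yy] : exists2 y, unit_cube y & Y @ G --> y.
  by apply: ultra_compact_cvg => //; apply: nearW => k; have [[]] := HS k.
have [s _ Ss] : exists2 s, unit_cube s & S @ G --> s.
  by apply: ultra_compact_cvg => //; apply: nearW => k; have [[]] := HS k.
have [|p _ Pp] := @ultra_compact_cvg _ _ P G _ GU (@norm_ball_compact R n K1).
  apply: nearW => k /=.
  by have [_ /HK1] := HS k.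
have [|q _ Qq] := @ultra_compact_cvg _ _ Q G _ GU (@norm_ball_compact R n K2).
  apply: nearW => k /=.
  by have [_ _ /HK2] := HS k.
have Ux : u1 (X k) @[k --> G] --> u1 x by apply: continuous_cvg Xx; exact: u1c.
have Uy : u2 (Y k) @[k --> G] --> u2 y by apply: continuous_cvg Yy; exact: u2c.
have Ws : w (S k) @[k --> G] --> w s by apply: continuous_cvg Ss; exact: wc.
have Dcvg : a * u1 (X k) 0 i + b * u2 (Y k) 0 i - w (S k) 0 i @[k --> G] -->
    a * u1 x 0 i + b * u2 y 0 i - w s 0 i.
  apply: cvgB; last exact: coord_cvg.
  by apply: cvgD; apply: cvgMr; exact: coord_cvg.
have harm : harmonic k @[k --> G] --> (0 : R).
  by apply: cvg_trans cvg_harmonic; exact: cvg_app.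
(* Comparing the penalized maximum with its value at the origin bounds
   k.+1 * a * gap and k.+1 * b * gap by a convergent sequence. *)
set D0 := a * u1 0 0 i + b * u2 0 0 i - w 0 0 i.
have ecvg c : (a * u1 (X k) 0 i + b * u2 (Y k) 0 i - w (S k) 0 i - D0) / c *
    harmonic k @[k --> G] --> (0 : R).
  rewrite -[X in _ --> X](mulr0 ((a * u1 x 0 i + b * u2 y 0 i - w s 0 i - D0) / c)).
  apply: cvgM harm; apply: cvgMl; by apply: (cvgB Dcvg); exact: cvg_cst.
have [k1 xs] : exists k, x = s + lattice k.
  apply: (cvg_gap0_lattice Xx Ss (ecvg a)); apply: filterS Gi => k Ik.
  have [_ _ _ _ /(_ i 0)] := HS k; rewrite Ik -/D0 => L.
  rewrite /harmonic/= -mulrA -invfM ler_pdivlMr ?mulr_gt0//.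
  have := mulr_ge0 (ltW b0) (gap_ge0 (Y k - S k)).
  have : 0 < k.+1%:R :> R by [].
  move: L; set g1 := torus_gap _; set g2 := torus_gap _; set t := k.+1%:R; nra.
have [k2 ys] : exists k, y = s + lattice k.
  apply: (cvg_gap0_lattice Yy Ss (ecvg b)); apply: filterS Gi => k Ik.
  have [_ _ _ _ /(_ i 0)] := HS k; rewrite Ik -/D0 => L.
  rewrite /harmonic/= -mulrA -invfM ler_pdivlMr ?mulr_gt0//.
  have := mulr_ge0 (ltW a0) (gap_ge0 (X k - S k)).
  have : 0 < k.+1%:R :> R by [].
  move: L; set g1 := torus_gap _; set g2 := torus_gap _; set t := k.+1%:R; nra.
have u1s : u1 x = u1 s by rewrite xs u1T.
have u2s : u2 y = u2 s by rewrite ys u2T.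
exists i, s, p, q; split.
- rewrite -u1s -(H_torus i p (u1 x) s k1) -xs.
  apply: (cvgr_to_le (equation_cvg H_cont (cvg_cst delta) Xx Pp Ux)).
  by apply: filterS Gi => k Ik; have [_ + _ _ _] := HS k; rewrite Ik.
- rewrite -u2s -(H_torus i q (u2 y) s k2) -ys.
  apply: (cvgr_to_le (equation_cvg H_cont (cvg_cst gamma) Yy Qq Uy)).
  by apply: filterS Gi => k Ik; have [_ _ + _ _] := HS k; rewrite Ik.
- have PQ : a *: P k + b *: Q k @[k --> G] --> a *: p + b *: q.
    by apply: cvgD; apply: cvgZr.
  apply: (cvgr_to_ge (equation_cvg H_cont (cvg_cst lambda) Ss PQ Ws)).
  by apply: filterS Gi => k Ik; have [_ _ _ + _] := HS k; rewrite Ik.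
- move=> j z; rewrite -u1s -u2s; apply: (cvgr_to_ge Dcvg).
  apply: filterS Gi => k Ik; have [_ _ _ _ /(_ j z)] := HS k; rewrite Ik.
  apply: le_trans; rewrite lerDl mulr_ge0// addr_ge0// mulr_ge0 ?gap_ge0//; exact: ltW.
Qed.

End max_principle.

(** * Comparison of convex combinations of subsolutions *)

Lemma hamiltonian_convex_le (R : realType) (n m : nat) (H : hamiltonians R n m)
    i x (p q : 'rV[R]_n) (u v : 'rV[R]_m) (a b : R) :
  convex_hamiltonians H -> 0 <= a -> 0 <= b -> a + b = 1 ->
  H i x (a *: p + b *: q) (a *: u + b *: v) <= a * H i x p u + b * H i x q v.
Proof.
move=> Hconv a0 b0 ab1; have a1 : a <= 1 by lra.
have bE : b = 1 - a by lra.
have := Hconv i x (Itv01 a0 a1) (p, u) (q, v).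
by rewrite bE; apply; rewrite inE.
Qed.

Section comparison.
Context (R : realType) (n m : nat) (H : hamiltonians R n m) (m_gt0 : (0 < m)%N).
Hypotheses (H_torus : torus_hamiltonians H)
  (H_cont : continuous_hamiltonians H) (H_coercive : coercive H)
  (H_convex : convex_hamiltonians H) (H_monotone : monotone_hamiltonians H).

(** Comparison for (P_lambda) when the subsolution is a convex combination of
    subsolutions of two other problems (P_delta) and (P_gamma).  The hypothesis
    on the sum says that the combination is a subsolution of (P_lambda) up to
    the error lambda c, which costs the constant c in the conclusion.  At the
    point given by the maximum principle, monotonicity replaces w by the
    combination inside H, and convexity splits H into the two known values. *)
Lemma convex_comparison (delta gamma lambda a b c : R)
    (u1 u2 w : 'rV[R]_n -> 'rV[R]_m) :
  0 < a -> 0 < b -> a + b = 1 -> 0 < lambda -> 0 <= c ->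
  continuous u1 -> continuous u2 -> continuous w ->
  viscosity_subsolution H delta u1 -> viscosity_subsolution H gamma u2 ->
  viscosity_supersolution H lambda w ->
  (forall j x, a * (lambda - delta) * u1 x 0 j +
               b * (lambda - gamma) * u2 x 0 j <= lambda * c) ->
  forall j x, a * u1 x 0 j + b * u2 x 0 j <= w x 0 j + c.
Proof.
move=> a0 b0 ab1 l0 c0 u1c u2c wc u1S u2S wS uc j x.
have [i [s [p1 [p2 [E1 E2 E3 umax]]]]] := nonsmooth_max_principle m_gt0 H_torus
  H_cont H_coercive a0 b0 u1c u2c wc u1S u2S wS.
suff : a * u1 s 0 i + b * u2 s 0 i - w s 0 i <= c by have := umax j x; lra.
pose U := a *: u1 s + b *: u2 s.
have UE k : U 0 k = a * u1 s 0 k + b * u2 s 0 k by rewrite !mxE.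
have [U0|U0] := leP 0 (U 0 i - w s 0 i); last by move: U0; rewrite UE; lra.
have HwU := @H_monotone s (a *: p1 + b *: p2) U (w s) i
  (fun k => ltac:(rewrite !UE; exact: umax)) U0.
have := hamiltonian_convex_le i s p1 p2 (u1 s) (u2 s) H_convex (ltW a0) (ltW b0) ab1.
rewrite -/U => HU; rewrite -(ler_pM2l l0).
have := uc i s; have := ler_wpM2l (ltW a0) E1; have := ler_wpM2l (ltW b0) E2.
rewrite !mulr0; move: E3 HwU HU; set h1 := H i s p1 _; set h2 := H i s p2 _.
by move=> *; lra.
Qed.

End comparison.

Lemma row_coord_continuous (R : realType) (n m : nat)
    (u : 'rV[R]_n -> 'rV[R]_m) i :
  continuous u -> continuous (fun x => u x 0 i).
Proof. by move=> uc x; exact: (coord_cvg (uc x)). Qed.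

(** * Uniform bounds *)

Lemma continuous_lsc (R : realType) (n : nat) (f : 'rV[R]_n -> R) :
  continuous f -> lsc f.
Proof.
move=> fc x a; rewrite lte_fin => afx; exists [set y | a < f y] => [|y /=].
  exact: (cvgr_gt _ (fc x)).
by rewrite lte_fin.
Qed.

Section bounds.
Context (R : realType) (n m : nat) (H : hamiltonians R n m) (m_gt0 : (0 < m)%N).
Hypotheses (H_torus : torus_hamiltonians H)
  (H_cont : continuous_hamiltonians H) (H_coercive : coercive H)
  (H_convex : convex_hamiltonians H) (H_monotone : monotone_hamiltonians H).

(** Adding the constant c makes all components nonnegative, which gives the
    discount term a sign, and by monotonicity does not decrease H. *)
Lemma supersolution_translate lambda c (u : 'rV[R]_n -> 'rV[R]_m) :
  continuous u -> 0 <= c -> 0 <= lambda -> (forall x, `|u x| <= c) ->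
  viscosity_supersolution H 0 u ->
  viscosity_supersolution H lambda (fun x => u x + const_mx c).
Proof.
move=> uc c0 l0 ub [uT _ uS].
have uE x i : (u x + const_mx c) 0 i = u x 0 i + c by rewrite !mxE.
split=> [x k|i|i phi x phiC umin]; first by rewrite uT.
  apply: continuous_lsc; under eq_fun do rewrite uE.
  by move=> x; apply: continuousD; [exact: row_coord_continuous|exact: cst_continuous].
have Hu : 0 <= H i x (grad phi x) (u x).
  have := uS i phi x phiC; rewrite mul0r add0r; apply=> y.
  by have := umin y; rewrite !uE; lra.
rewrite addr_ge0//.
  rewrite mulr_ge0// uE; have := le_trans (row_norm_coord (u x) i) (ub x).
  by rewrite ler_norml; lra.
apply: le_trans Hu _; apply: H_monotone => [j|]; rewrite !uE; lra.
Qed.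

(** Both bounds are instances of [convex_comparison] with u1 = u2: for the lower
    one u is a subsolution of (P_lambda) up to lambda c, for the upper one u + c
    is a supersolution. *)
Lemma discounted_bound u lambda c v : 0 <= c -> 0 < lambda ->
  (forall x, `|u x| <= c) ->
  viscosity_solution H 0 u -> viscosity_solution H lambda v ->
  forall x, `|v x| <= 2 * c.
Proof.
move=> c0 l0 ub [uc usub usup] [vc vsub vsup] x.
have ubj y j : - c <= u y 0 j <= c.
  by rewrite -ler_norml; exact: le_trans (row_norm_coord _ _) (ub y).
apply: row_norm_le => [|j]; first by rewrite mulr_ge0.
have h0 : 0 < 2^-1 :> R by rewrite invr_gt0.
have h1 : 2^-1 + 2^-1 = 1 :> R by lra.
have := convex_comparison m_gt0 H_torus H_cont H_coercive H_convex H_monotone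
  h0 h0 h1 l0 c0 uc uc vc usub usub vsup.
have ucc : continuous (fun x => u x + const_mx c).
  by move=> y; apply: (cvgD (uc y)); exact: cvg_cst.
have := convex_comparison m_gt0 H_torus H_cont H_coercive H_convex H_monotone
  h0 h0 h1 l0 (lexx 0) vc vc ucc vsub vsub
  (supersolution_translate uc c0 (ltW l0) ub usup).
move=> /(_ _ j x) up /(_ _ j x) lo.
have {}up : v x 0 j <= u x 0 j + c.
  have := up (fun k y => ltac:(by rewrite subrr; lra)); rewrite !mxE; lra.
have {}lo : u x 0 j <= v x 0 j + c.
  have := lo (fun k y => ltac:(have := ubj y k; nra)); lra.
by have := ubj x j; rewrite ler_norml; lra.
Qed.

End bounds.

(** * Equicontinuity of bounded subsolutions *)

Lemma enormZ_sqr (R : realType) (n : nat) (c : R) (p : 'rV[R]_n) :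
  enorm (c *: p) ^+ 2 = c ^+ 2 * enorm p ^+ 2.
Proof.
rewrite !sqr_sqrtr; try by apply: sumr_ge0 => j _; exact: sqr_ge0.
by rewrite mulr_sumr; apply: eq_bigr => j _; rewrite mxE exprMn.
Qed.

(** The power with exponent 1/2 agrees with the square root on nonnegative
    arguments and is differentiable at positive ones; e keeps the argument
    positive on the lattice. *)
Lemma sqrt_gap_C1 (R : realType) (n : nat) (e : R) : 0 < e ->
  C1_with_grad (fun y : 'rV[R]_n => (e + torus_gap y) `^ 2^-1)
    (fun y => (2 * Num.sqrt (e + torus_gap y))^-1 *: grad_gap y).
Proof.
move=> e0.
have eg0 (y : 'rV[R]_n) : 0 < e + torus_gap y by rewrite ltr_pwDl// gap_ge0.
apply: (@C1_comp _ _ _ _ (fun t => (e + t) `^ 2^-1)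
    (fun t => (2 * Num.sqrt (e + t))^-1)); last exact: gap_C1.
- move=> y.
  have dp : is_derive (e + torus_gap y) 1 (@powR R ^~ 2^-1)
      (2^-1 * (e + torus_gap y) `^ (2^-1 - 1)) by exact: is_derive1_powR.
  have ds : is_derive (torus_gap y) 1 (fun t => e + t) 1.
    rewrite (_ : (fun t => e + t) = cst e + id)//.
    by apply: is_derive_eq; rewrite add0r.
  apply: (is_derive_eq (is_derive1_comp dp ds)); rewrite mulr1.
  rewrite (_ : 2^-1 - 1 = - 2^-1); last by lra.
  by rewrite powRN powR12_sqrt ?ltW// invfM.
- move=> y; apply: (@continuous_comp _ _ _ (@torus_gap R n)
    (fun t => (2 * Num.sqrt (e + t))^-1)); first exact: gap_continuous.
  apply: continuousV; first by rewrite mulf_neq0// gt_eqF// sqrtr_gt0.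
  apply: continuousM; first exact: cst_continuous.
  apply: (@continuous_comp _ _ _ (fun t => e + t) Num.sqrt);
    last exact: sqrt_continuous.
  by apply: continuousD; [exact: cst_continuous|exact: cvg_id].
Qed.

Section modulus.
Context (R : realType) (n m : nat) (H : hamiltonians R n m).
Hypothesis (H_coercive : coercive H).

(** The function L sqrt(S(z - x)) is a cone with vertex x, whose slope exceeds
    the bound given by coercivity; u cannot leave it.  Its regularization
    L sqrt(eta^2 + S(z - x)) is an admissible test function with a large slope
    as soon as eta^2 < S <= 1/2, so that its difference with u is
    maximal at a point where S <= eta^2.  This point then tends to x when eta
    tends to zero. *)
Lemma subsolution_modulus C : 0 <= C -> exists2 L : R, 0 <= L &
  forall lambda u, 0 <= lambda <= 1 -> continuous u ->
    (forall x, `|u x| <= C) -> viscosity_subsolution H lambda u ->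
  forall i x z, u z 0 i - u x 0 i <= L * Num.sqrt (torus_gap (z - x)).
Proof.
move=> C0; have [K HK] := coercive_bound C H_coercive.
pose K2 := n%:R * `|K|; have K20 : 0 <= K2 by rewrite mulr_ge0.
(* K2 makes the cone steeper than any admissible slope; 8 C keeps the maximum in
   the region S <= 1/2, since u oscillates by at most 2 C. *)
pose L := K2 + 8 * C + 1; have L0 : 0 < L by rewrite /L; lra.
exists L => [|lambda u /andP[l0 l1] uc ub [uT _ uS] i x z]; first exact: ltW.
have uij y : - C <= u y 0 i <= C.
  by rewrite -ler_norml; exact: le_trans (row_norm_coord _ _) (ub y).
have slope phi y : torus_C1 phi ->
    (forall t, u t 0 i - phi t <= u y 0 i - phi y) ->
    enorm (grad phi y) ^+ 2 <= K2 ^+ 2.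
  move=> phiC /(uS _ _ _ phiC) S; rewrite lerXn2r ?nnegrE ?sqrtr_ge0//.
  apply: le_trans (enorm_le _) _; rewrite ler_wpM2l//.
  apply: le_trans (ler_norm K); apply: HK (ub y) _.
  by have := uij y; nra.
have step eta : 0 < eta <= 4^-1 -> exists y, [/\ unit_cube y,
    torus_gap (y - x) <= eta ^+ 2 &
    u z 0 i - L * Num.sqrt (eta ^+ 2 + torus_gap (z - x)) <= u y 0 i].
  move=> /andP[e0 e4]; have e20 : 0 < eta ^+ 2 by rewrite exprn_gt0.
  pose phi t := L * (eta ^+ 2 + torus_gap (t - x)) `^ 2^-1.
  have phiE t : phi t = L * Num.sqrt (eta ^+ 2 + torus_gap (t - x)).
    by rewrite /phi powR12_sqrt// addr_ge0 ?gap_ge0// ltW.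
  have phiC := C1_scale L (C1_shift x (@sqrt_gap_C1 R n _ e20)).
  have phiT : torus_fun phi.
    by move=> t k; rewrite /phi (torus_fun_shift x (@gap_torus R n)).
  have [||y Cy ymax] := @torus_max R n (fun t => u t 0 i - phi t).
  - move=> t; apply: continuousB; first exact: row_coord_continuous.
    by apply: differentiable_continuous; have [] := phiC.
  - by move=> t k; rewrite uT phiT.
  have := slope phi y (torus_C1_from_grad phiT phiC) ymax.
  have [_ -> _] := phiC; rewrite scalerA enormZ_sqr.
  have r0 : 0 <= Num.sqrt (eta ^+ 2 + torus_gap (y - x)) by exact: sqrtr_ge0.
  have r2 : Num.sqrt (eta ^+ 2 + torus_gap (y - x)) ^+ 2 =
      eta ^+ 2 + torus_gap (y - x) by rewrite sqr_sqrtr// addr_ge0 ?gap_ge0// ltW.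
  have := gap_ge0 (y - x); have := @grad_gap_lower R n (y - x).
  have := ymax x; rewrite !phiE subrr gap0 addr0 sqrtr_sqr (gtr0_norm e0).
  move: r0 r2; set r := Num.sqrt _; set g := torus_gap _; set D := enorm _.
  move=> r0 r2 Mx gD g0.
  have r_le : r <= 2^-1.
    rewrite -(ler_pM2l L0); have := uij x; have := uij y; rewrite /L in Mx *; nra.
  have {}gD : 8 * g <= D ^+ 2 by apply: gD; nra.
  have rp : 0 < r by rewrite lt_neqAle r0 andbT; apply/eqP => r00; nra.
  move=> slopeK; exists y; split=> //.
    have : L ^+ 2 * D ^+ 2 <= K2 ^+ 2 * (2 * r) ^+ 2.
      move: slopeK; rewrite exprMn exprVn mulrAC ler_pdivrMr//.
      by rewrite exprn_gt0// mulr_gt0.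
    have : K2 ^+ 2 <= L ^+ 2.
      rewrite lerXn2r ?nnegrE ?(ltW L0)//.
      by rewrite /L; clear -C0; lra.
    have : 0 < L ^+ 2 by rewrite exprn_gt0.
    rewrite [(2 * r) ^+ 2]exprMn r2 -/g.
    move: (L ^+ 2) (K2 ^+ 2) (D ^+ 2) (eta ^+ 2) gD e20.
    move=> l k d e gD e20 l0' kl lk; rewrite -(ler_pM2l l0').
    have : 0 <= l * (d - 8 * g) by rewrite mulr_ge0 ?subr_ge0// ltW.
    have : 0 <= (l - k) * (e + g) by rewrite mulr_ge0 ?subr_ge0// addr_ge0// ltW.
    rewrite expr2 in lk; lra.
  have := ymax z; rewrite !phiE -/g -/r.
  have : 0 <= L * r by rewrite mulr_ge0// ltW.
  lra.
have /choice[Y HY] k : exists y, [/\ unit_cube y,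
    torus_gap (y - x) <= (4^-1 * @harmonic R k) ^+ 2 &
    u z 0 i - L * Num.sqrt ((4^-1 * @harmonic R k) ^+ 2 + torus_gap (z - x)) <= u y 0 i].
  apply: step; rewrite mulr_gt0//= ger_pMr// /harmonic/= invf_le1// ler1n//.
have [G [GU GF]] := ultraFilterLemma (@eventually_filter).
have [|y _ Yy] := @ultra_compact_cvg _ _ Y G _ GU (@unit_cube_compact R n).
  by apply: nearW => k; have [] := HY k.
have hcvg : 4^-1 * @harmonic R k @[k --> G] --> (0 : R).
  rewrite -[X in _ --> X](mulr0 4^-1); apply: cvgMr.
  by apply: cvg_trans cvg_harmonic; exact: cvg_app.
have ecvg : (4^-1 * @harmonic R k) ^+ 2 @[k --> G] --> (0 : R).
  by rewrite -[X in _ --> X](mulr0 0); exact: (cvgM hcvg hcvg).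
have [k yx] : exists k, y = x + lattice k.
  apply: (cvg_gap0_lattice Yy (cvg_cst x) ecvg).
  by apply: nearW => k; have [] := HY k.
rewrite lerBlDr -lerBlDl -(uT x k) -yx.
have Uy : u (Y k) 0 i @[k --> G] --> u y 0 i.
  by apply: coord_cvg; apply: continuous_cvg Yy; exact: uc.
apply: (ler_cvg_to _ Uy (f := fun k => u z 0 i - L * Num.sqrt ((4^-1 * @harmonic R k) ^+ 2 + torus_gap (z - x)))).
  apply: cvgB; first exact: cvg_cst.
  apply: cvgMr; apply: continuous_cvg; first exact: sqrt_continuous.
  rewrite -[X in _ --> X]add0r; apply: cvgD ecvg _; exact: cvg_cst.
by apply: nearW => j; have [] := HY j.
Qed.

End modulus.

(** * Uniform limits of solutions *)

Lemma uniform_cvgP (R : realType) (n m : nat) (T : Type) (F : set_system T)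
    {FF : Filter F} (v : T -> 'rV[R]_n -> 'rV[R]_m) (w : 'rV[R]_n -> 'rV[R]_m) :
  {uniform, v t @[t --> F] --> w} <->
  forall e, 0 < e -> \forall t \near F, forall x, `|v t x - w x| <= e.
Proof.
split=> [vw e e0|vw].
  have /vw : nbhs (w : {uniform _ -> _}) [set h : 'rV[R]_n -> 'rV[R]_m |
      forall x, `|h x - w x| <= e].
    apply/uniform_nbhs; exists [set ab | ball ab.1 e ab.2].
    split; first exact: (entourage_ball _ (PosNum e0)).
    move=> h hw x; have := hw x I; rewrite /= mx_norm_ball /ball_/= distrC.
    exact: ltW.
  by [].
move=> P /uniform_nbhs[E [entE EP]].
move: entE; rewrite -entourage_from_ballE => -[e /= e0 eE].
have e20 : 0 < e / 2 by rewrite divr_gt0.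
have := vw _ e20; apply: filterS => t vwt; apply: EP => x _; apply: eE => /=.
rewrite mx_norm_ball /ball_/= distrC; apply: le_lt_trans (vwt x) _.
by rewrite ltr_pdivrMr// ltr_pMr// ltr1n.
Qed.

Lemma norm_gap_modulus (R : realType) (n m : nat) (u : 'rV[R]_n -> 'rV[R]_m) L :
  0 <= L ->
  (forall i x z, u z 0 i - u x 0 i <= L * Num.sqrt (torus_gap (z - x))) ->
  forall x z, `|u z - u x| <= L * Num.sqrt (torus_gap (z - x)).
Proof.
move=> L0 uL x z; apply: row_norm_le => [|j].
  by rewrite mulr_ge0// sqrtr_ge0.
rewrite !mxE ler_norml uL andbT lerNl opprB.
by rewrite -[z - x]opprB gapN; exact: uL.
Qed.

(** Along an ultrafilter the pointwise limit exists at once by compactness of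
    balls; the common modulus passes to the limit and, by compactness of the unit
    cube, makes the convergence uniform. *)
Lemma equicontinuous_ultra_cvg (R : realType) (n m : nat) (T : Type)
    (G : set_system T) (GU : UltraFilter G) (v : T -> 'rV[R]_n -> 'rV[R]_m)
    (C L : R) : 0 <= L ->
  (\forall t \near G, [/\ torus_fun (v t), forall x, `|v t x| <= C &
    forall i x z, v t z 0 i - v t x 0 i <= L * Num.sqrt (torus_gap (z - x))]) ->
  exists w, [/\ continuous w, torus_fun w & {uniform, v t @[t --> G] --> w}].
Proof.
move=> L0 vG.
have /choice[w vw] (x : 'rV[R]_n) : exists l : 'rV[R]_m, v t x @[t --> G] --> l.
  have [|l _ vl] := @ultra_compact_cvg _ _ (fun t => v t x) G _ GU
    (@norm_ball_compact R m C); last by exists l.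
  by apply: filterS vG => t [_ vC _]; exact: vC.
have wL i x z : w z 0 i - w x 0 i <= L * Num.sqrt (torus_gap (z - x)).
  apply: (cvgr_to_le (cvgB (coord_cvg (vw z)) (coord_cvg (vw x)))).
  by apply: filterS vG => t [_ _ vL]; exact: vL.
have wN := norm_gap_modulus L0 wL.
have gc x : continuous (fun z : 'rV[R]_n => L * Num.sqrt (torus_gap (z - x))).
  move=> z; apply: (@continuous_comp _ _ _ (fun z : 'rV[R]_n => torus_gap (z - x))
    (fun t => L * Num.sqrt t)).
    by apply: differentiable_continuous; have [] := C1_shift x (@gap_C1 R n).
  by apply: continuousM; [exact: cst_continuous|exact: sqrt_continuous].
have gap_near (e : R) (x : 'rV[R]_n) : 0 < e ->
    \forall z \near x, L * Num.sqrt (torus_gap (z - x)) <= e.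
  move=> e0; have /cvgr_le h := gc x x; apply: h.
  by rewrite /= subrr gap0 sqrtr0 mulr0.
have wT : torus_fun w.
  move=> x k; apply/eqP; rewrite -subr_eq0 -normr_le0.
  apply: le_trans (wN _ _) _.
  by rewrite addrAC subrr (gap_torus 0 k) gap0 sqrtr0 mulr0.
exists w; split=> //.
  move=> x; apply/(@cvgrPdist_le _ _ _ (nbhs x) _) => e e0.
  apply: filterS (gap_near e x e0) => z; rewrite distrC.
  exact: le_trans (wN x z).
apply/uniform_cvgP => e e0.
have e30 : 0 < e / 3 by rewrite divr_gt0.
have cov : \near G, @unit_cube R n `<=` (fun x => `|v G x - w x| <= e).
  apply: (iffLR (compact_near_coveringP _) (@unit_cube_compact R n) T G
    (fun t x => `|v t x - w x| <= e)) => x _.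
  have vwx : \forall t \near G, `|v t x - w x| <= e / 3.
    by have /cvgrPdist_le/(_ _ e30) := vw x; apply: filterS => t; rewrite distrC.
  exists ([set z | L * Num.sqrt (torus_gap (z - x)) <= e / 3],
     [set t | `|v t x - w x| <= e / 3 /\ (forall i x z, v t z 0 i - v t x 0 i <=
         L * Num.sqrt (torus_gap (z - x)))]) => /=.
    by split; [exact: gap_near|apply: filterS2 vwx vG => t ? []].
  move=> [z t] /= [gz [vwt /(norm_gap_modulus L0) vL]].
  have -> : v t z - w z = (v t z - v t x) + (v t x - w x) + (w x - w z).
    by rewrite !addrA !subrK.
  apply: le_trans (ler_normD _ _) _.
  have := ler_normD (v t z - v t x) (v t x - w x).
  have := vL x z; have := wN x z; rewrite [`|w z - _|]distrC.
  move: (`|_ - _|) (`|_ - _|) => A B; lra.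
apply: filterS2 cov vG => t vt [vT _ _] x.
have [k Ck] := unit_cube_repr x.
by rewrite -(vT x k) -(wT x k); exact: vt.
Qed.

(** Adding S(z - x) to the test function makes the maximum at x strict on the
    torus without changing the gradient there, so that maxima of the
    approximating problems converge to x modulo the lattice. *)
Lemma subsolution_uniform_limit (R : realType) (n m : nat) (H : hamiltonians R n m)
    (T : Type) (G : set_system T) (GU : UltraFilter G) (lambda : T -> R)
    (v : T -> 'rV[R]_n -> 'rV[R]_m) (lambda0 : R) (w : 'rV[R]_n -> 'rV[R]_m) :
  torus_hamiltonians H -> continuous_hamiltonians H ->
  lambda @ G --> lambda0 ->
  (\forall t \near G, continuous (v t) /\
     viscosity_subsolution H (lambda t) (v t)) ->
  continuous w -> torus_fun w -> {uniform, v t @[t --> G] --> w} ->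
  viscosity_subsolution H lambda0 w.
Proof.
move=> HT Hc ll vS wc wT vw; split=> // [i|i phi x phiC wmax].
  apply: continuous_lsc => x; apply: continuousN.
  exact: (row_coord_continuous (i := i) wc).
have [phiT phid phig] := phiC.
pose psi z := phi z + torus_gap (z - x).
have psiC : C1_with_grad psi (fun z => grad phi z + grad_gap (z - x)).
  by apply: C1_add; [exact: torus_C1_with_grad|exact/C1_shift/gap_C1].
have psiT : torus_fun psi.
  by move=> z k; rewrite /psi phiT (torus_fun_shift x (@gap_torus R n)).
have /choice[Y HY] t : exists y, unit_cube y /\
    (continuous (v t) /\ viscosity_subsolution H (lambda t) (v t) ->
     [/\ forall z, v t z 0 i - psi z <= v t y 0 i - psi y &
     lambda t * v t y 0 i + H i y (grad phi y + grad_gap (y - x)) (v t y) <= 0]).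
  have [[vc [vT vu vs]]|nv] :=
      pselect (continuous (v t) /\ viscosity_subsolution H (lambda t) (v t)); last first.
    by exists 0; split=> // j; rewrite mxE/= in_itv/= lexx ler01.
  have [||y Cy ymax] := @torus_max R n (fun z => v t z 0 i - psi z).
  - move=> z; apply: continuousB; first exact: row_coord_continuous.
    by apply: differentiable_continuous; have [] := psiC.
  - by move=> z k; rewrite vT psiT.
  exists y; split=> // _; split=> //.
  by have := vs i psi y (torus_C1_from_grad psiT psiC) ymax; have [_ -> _] := psiC.
have [|y _ Yy] := @ultra_compact_cvg _ _ Y G _ GU (@unit_cube_compact R n).
  by apply: nearW => t; have [] := HY t.
have dcvg : v t (Y t) - w (Y t) @[t --> G] --> (0 : 'rV[R]_m).
  apply/cvgrPdist_le => e e0; move/uniform_cvgP : vw => /(_ e e0).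
  by apply: filterS => t; rewrite sub0r normrN.
have wY : w (Y t) @[t --> G] --> w y by apply: continuous_cvg Yy; exact: wc.
have vY : v t (Y t) @[t --> G] --> w y.
  rewrite -[X in _ --> X]add0r.
  have vE : (fun t => v t (Y t)) = (fun t => v t (Y t) - w (Y t) + w (Y t)).
    by apply/funext => t; rewrite subrK.
  by rewrite vE; exact: cvgD.
have vx : v t x - w x @[t --> G] --> (0 : 'rV[R]_m).
  apply/cvgrPdist_le => e e0; move/uniform_cvgP : vw => /(_ e e0).
  by apply: filterS => t; rewrite sub0r normrN.
have ecvg : (v t (Y t) - w (Y t)) 0 i - (v t x - w x) 0 i @[t --> G] --> (0 : R).
  rewrite [X in _ --> X](_ : 0 = (0 : 'rV[R]_m) 0 i - (0 : 'rV[R]_m) 0 i);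
    last by rewrite !mxE subr0.
  by apply: cvgB; exact: coord_cvg.
have [k yx] : exists k, y = x + lattice k.
  apply: (cvg_gap0_lattice Yy (cvg_cst x) ecvg); apply: filterS vS => t vt.
  have [_ /(_ vt)[/(_ x) + _]] := HY t.
  by rewrite /psi subrr gap0 !mxE; have := wmax (Y t); lra.
have gy : grad phi x = grad phi y + grad_gap (y - x).
  have gT : torus_fun (@grad_gap R n).
    have [_ /funext <- _] := @gap_C1 R n; exact/grad_torus/gap_torus.
  rewrite yx (grad_torus phiT) addrAC subrr gT.
  by rewrite [X in _ + X](_ : _ = 0) ?addr0//; apply/rowP => j;
    rewrite !mxE mulr0 sin0 mulr0 mul0r.
have wyx : w y = w x by rewrite yx wT.
rewrite gy -wyx -(HT i _ (w y) x k) -yx.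
have Pc : grad phi (Y t) + grad_gap (Y t - x) @[t --> G] -->
    grad phi y + grad_gap (y - x).
  by have [_ _ gc] := psiC; apply: (continuous_cvg _ (gc y) Yy).
apply: (cvgr_to_le (equation_cvg Hc ll Yy Pc vY)).
by apply: filterS vS => t vt; have [_ /(_ vt)[]] := HY t.
Qed.

(** Supersolutions of H are the opposites of subsolutions of this system, which
    transfers stability from subsolutions to supersolutions. *)
Definition reflected (R : realType) (n m : nat) (H : hamiltonians R n m) :
  hamiltonians R n m := fun i x p u => - H i x (- p) (- u).

Lemma torus_C1_opp (R : realType) (n : nat) (phi : 'rV[R]_n -> R) : torus_C1 phi ->
  torus_C1 (fun x => - phi x) /\ forall x, grad (fun x => - phi x) x = - grad phi x.
Proof.
move=> phiC; have [phiT _ _] := phiC.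
have := C1_scale (-1) (torus_C1_with_grad phiC).
rewrite (_ : (fun x => -1 * phi x) = (fun x => - phi x)); last first.
  by apply/funext => x; rewrite mulN1r.
move=> nC; split; last by move=> x; have [_ -> _] := nC; rewrite scaleN1r.
by apply: torus_C1_from_grad nC => x k; rewrite phiT.
Qed.

Lemma reflected_continuous (R : realType) (n m : nat) (H : hamiltonians R n m) :
  continuous_hamiltonians H -> continuous_hamiltonians (reflected H).
Proof.
move=> Hc i z; apply: cvgN.
apply: (@hamiltonian_cvg _ _ _ _ _ (nbhs z) _ (fun z => z.1.1)
  (fun z => - z.1.2) (fun z => - z.2)) => //.
- exact: (cvg_comp _ _ cvg_fst cvg_fst).
- by apply: cvgN; exact: (cvg_comp _ _ cvg_fst cvg_snd).
- by apply: cvgN; exact: cvg_snd.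
Qed.

Lemma supersolution_reflected (R : realType) (n m : nat) (H : hamiltonians R n m) lambda
    (w : 'rV[R]_n -> 'rV[R]_m) : continuous w ->
  viscosity_supersolution H lambda w <->
  viscosity_subsolution (reflected H) lambda (fun x => - w x).
Proof.
move=> wc.
have usc_w i : usc (fun x => (- w x) 0 i).
  rewrite /usc (_ : (fun x => - _) = (fun x => w x 0 i)).
    exact/continuous_lsc/row_coord_continuous.
  by apply/funext => x; rewrite mxE opprK.
have lsc_w i : lsc (fun x => w x 0 i).
  exact/continuous_lsc/row_coord_continuous.
split=> -[wT _ wS]; split=> //.
- by move=> x k; rewrite wT.
- move=> i phi x phiC wmax; rewrite /reflected opprK.
  have [nC <-] := torus_C1_opp phiC.
  have := wS i _ x nC; rewrite !mxE => wS'.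
  rewrite mulrN -opprD oppr_le0; apply: wS' => y.
  by have := wmax y; rewrite !mxE; lra.
- by move=> x k; apply: oppr_inj; rewrite wT.
- move=> i phi x phiC wmin.
  have [nC nE] := torus_C1_opp phiC.
  have := wS i _ x nC; rewrite /reflected nE !opprK !mxE mulrN -opprD oppr_le0.
  by apply=> y; have := wmin y; rewrite !mxE; lra.
Qed.

Lemma solution_uniform_limit (R : realType) (n m : nat) (H : hamiltonians R n m)
    (T : Type) (G : set_system T) (GU : UltraFilter G) (lambda : T -> R)
    (v : T -> 'rV[R]_n -> 'rV[R]_m) (lambda0 : R) (w : 'rV[R]_n -> 'rV[R]_m) :
  torus_hamiltonians H -> continuous_hamiltonians H ->
  lambda @ G --> lambda0 ->
  (\forall t \near G, viscosity_solution H (lambda t) (v t)) ->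
  continuous w -> torus_fun w -> {uniform, v t @[t --> G] --> w} ->
  viscosity_solution H lambda0 w.
Proof.
move=> HT Hc ll vS wc wT vw; split=> //.
  by apply: (subsolution_uniform_limit GU HT Hc ll _ wc wT vw); apply: filterS vS => t [].
apply/supersolution_reflected => //.
apply: (@subsolution_uniform_limit _ _ _ _ _ _ GU lambda (fun t x => - v t x)) => //.
- by move=> i p u x k; rewrite /reflected HT.
- exact: reflected_continuous.
- apply: filterS vS => t [vc _ vs]; split; last exact/supersolution_reflected.
  by move=> x; exact: (cvgN (vc x)).
- by move=> x; exact: (cvgN (wc x)).
- by move=> x k; rewrite wT.
- apply/uniform_cvgP => e /(iffLR (uniform_cvgP _ _) vw).
  by apply: filterS => t vt x; rewrite -opprD normrN.
Qed.

(** * The vanishing discount limit *)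

Section limits.
Context (R : realType) (n m : nat) (H : hamiltonians R n m) (m_gt0 : (0 < m)%N).
Hypotheses (H_torus : torus_hamiltonians H)
  (H_cont : continuous_hamiltonians H) (H_coercive : coercive H)
  (H_convex : convex_hamiltonians H) (H_monotone : monotone_hamiltonians H).
Variable v : R -> 'rV[R]_n -> 'rV[R]_m.
Hypothesis v_sol : forall lambda, 0 < lambda ->
  viscosity_solution H lambda (v lambda).

(** The heart of the argument: v^delta is close to w, and for lambda < delta the
    combination of v^delta and w with weights lambda / delta and
    1 - lambda / delta is compared with v^lambda.  These weights make the error
    term equal to lambda (1 - lambda / delta) (w - v^delta), which is small
    relative to lambda.  Then delta stays fixed while lambda tends to zero. *)
Lemma limit_points_le (F G : set_system R) {FF : ProperFilter F} {GF : ProperFilter G}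
    (w w' : 'rV[R]_n -> 'rV[R]_m) :
  0^'+ `<=` F -> 0^'+ `<=` G ->
  continuous w -> viscosity_subsolution H 0 w ->
  {uniform, v lambda @[lambda --> F] --> w} ->
  {uniform, v lambda @[lambda --> G] --> w'} ->
  forall j x, w x 0 j <= w' x 0 j.
Proof.
move=> F0 G0 wc wS vw vw' j x; apply/ler_addgt0Pr => e e0.
have [delta [d0 vdw]] : exists delta, 0 < delta /\ forall x, `|v delta x - w x| <= e.
  apply: (@filter_ex _ F); apply: filterI.
    by apply: F0; exact: nbhs_right_gt.
  by move/uniform_cvgP : vw; apply.
have key lambda : 0 < lambda < delta ->
    lambda / delta * v delta x 0 j + (1 - lambda / delta) * w x 0 j <=
    v lambda x 0 j + e.
  move=> /andP[l0 ld]; have a0 : 0 < lambda / delta by rewrite divr_gt0.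
  have a1 : lambda / delta < 1 by rewrite ltr_pdivrMr// mul1r.
  have b0 : 0 < 1 - lambda / delta by rewrite subr_gt0.
  have ab : lambda / delta + (1 - lambda / delta) = 1 by rewrite addrC subrK.
  have [dc dS _] := v_sol d0; have [lc _ lS] := v_sol l0.
  apply: (convex_comparison m_gt0 H_torus H_cont H_coercive H_convex H_monotone
    a0 b0 ab l0 (ltW e0) dc wc lc dS wS lS) => k y.
  rewrite (_ : lambda / delta * (lambda - delta) =
    - (lambda * (1 - lambda / delta))); last by field; rewrite gt_eqF.
  have := le_trans (row_norm_coord (v delta y - w y) k) (vdw y).
  rewrite !mxE ler_norml => /andP[L _].
  rewrite (_ : _ + _ = lambda * ((1 - lambda / delta) * (w y 0 k - v delta y 0 k)));
    last by ring.
  rewrite ler_pM2l//; nra.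
have idG : lambda @[lambda --> G] --> (0 : R).
  by apply: cvg_trans (cvg_at_right_filter cvg_id); exact: cvg_app.
have aG : lambda / delta @[lambda --> G] --> (0 : R).
  by rewrite -[X in _ --> X](mul0r delta^-1); apply: cvgMl.
have vG : v lambda x 0 j + e @[lambda --> G] --> w' x 0 j + e.
  apply: cvgD; last exact: cvg_cst; apply: coord_cvg.
  apply/cvgrPdist_le => d dd; move/uniform_cvgP : vw' => /(_ d dd).
  by apply: filterS => t; rewrite distrC.
have lG : lambda / delta * v delta x 0 j + (1 - lambda / delta) * w x 0 j
    @[lambda --> G] --> 0 * v delta x 0 j + (1 - 0) * w x 0 j.
  apply: cvgD; apply: cvgMl => //; apply: cvgB aG; exact: cvg_cst.
rewrite -[leLHS]add0r -[X in X + _ <= _](mul0r (v delta x 0 j)) -[X in _ + X <= _]mul1r.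
rewrite -[X in _ + X * _ <= _]subr0.
apply: (ler_cvg_to lG vG); apply: G0; near=> lambda.
by apply: key; apply/andP; split; near: lambda;
  [exact: nbhs_right_gt|exact: nbhs_right_lt].
Unshelve. all: end_near. Qed.

End limits.

Lemma ultrafilter_limit_solves (R : realType) (n m : nat) (H : hamiltonians R n m)
    (v : R -> 'rV[R]_n -> 'rV[R]_m) (G : set_system R) (GU : UltraFilter G) :
  (0 < m)%N -> torus_hamiltonians H -> continuous_hamiltonians H ->
  coercive H -> convex_hamiltonians H -> monotone_hamiltonians H ->
  (exists u, viscosity_solution H 0 u) ->
  (forall lambda, 0 < lambda -> viscosity_solution H lambda (v lambda)) ->
  0^'+ `<=` G ->
  exists w, viscosity_solution H 0 w /\
    {uniform, v lambda @[lambda --> G] --> w}.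
Proof.
move=> m0 HT Hc Hco Hcv Hm [u uS] vS G0.
have [uc [uT _ _] _] := uS; have [c c0 ub] := torus_bounded uc uT.
have [|L L0 HL] := subsolution_modulus Hco (C := 2 * c).
  by rewrite mulr_ge0.
have pos : \forall lambda \near G, 0 < lambda by apply: G0; exact: nbhs_right_gt.
have [|w [wc wT vw]] := @equicontinuous_ultra_cvg R n m R G GU v (2 * c) L L0.
  have le1 : \forall lambda \near G, lambda < 1.
    by apply: G0; exact: nbhs_right_lt.
  apply: filterS2 pos le1 => lambda l0 l1.
  have [lc ls _] := vS _ l0; have [lT _ _] := ls.
  have vb := discounted_bound m0 HT Hc Hco Hcv Hm c0 l0 ub uS (vS _ l0).
  by split=> //; apply: (HL lambda); rewrite // ltW//= ltW.
exists w; split=> //.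
have idG : lambda @[lambda --> G] --> (0 : R).
  by apply: cvg_trans (cvg_at_right_filter cvg_id); exact: cvg_app.
by apply: (solution_uniform_limit GU HT Hc idG _ wc wT vw); apply: filterS pos.
Qed.

Theorem theorem16 (R : realType) (n m : nat) (n_gt0 : (0 < n)%N)
  (m_gt0 : (0 < m)%N) (H : hamiltonians R n m)
  (H_torus : torus_hamiltonians H)
  (H_cont : continuous_hamiltonians H)
  (H_coercive : coercive H)
  (H_convex : convex_hamiltonians H)
  (H_monotone : monotone_hamiltonians H)
  (P0_solvable : exists u : 'rV[R]_n -> 'rV[R]_m, viscosity_solution H 0 u)
  (v : R -> 'rV[R]_n -> 'rV[R]_m)
  (v_sol : forall lambda : R, 0 < lambda ->
     viscosity_solution H lambda (v lambda)) :
  exists v0 : 'rV[R]_n -> 'rV[R]_m,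
    viscosity_solution H 0 v0 /\
    {uniform, v lambda @[lambda --> 0^'+] --> v0}.
Proof.
have lim G (GU : UltraFilter G) := ultrafilter_limit_solves GU m_gt0 H_torus H_cont
  H_coercive H_convex H_monotone P0_solvable v_sol.
have [G [GU G0]] := ultraFilterLemma (at_right_proper_filter (0 : R)).
have [w [wS vw]] := lim G GU G0.
exists w; split=> //; apply/uniform_cvgP => e e0.
pose A := [set lambda | forall x, `|v lambda x - w x| <= e].
(* If v^lambda stayed away from w for arbitrarily small lambda, an ultrafilter
   containing these lambda would have another limit point. *)
apply: contrapT => nA.
have FP : ProperFilter (within (~` A) (0 : R)^'+).
  split; last exact: within_filter.
  move=> h; apply: nA.
  have : \forall t \near (0 : R)^'+, ~ A t -> False by exact: h.
  by apply: filterS => t /contrapT.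
have [G' [GU' G0']] := ultraFilterLemma FP.
have G'0 : 0^'+ `<=` G'.
  by move=> B B0; apply: G0'; apply: filterS B0.
have [w' [wS' vw']] := lim G' GU' G'0.
have ww' : w' = w.
  have [wc ws _] := wS; have [wc' ws' _] := wS'.
  have le := limit_points_le m_gt0 H_torus H_cont H_coercive H_convex H_monotone v_sol.
  apply/funext => x; apply/rowP => j; apply/eqP; rewrite eq_le.
  by rewrite (le _ _ _ _ _ _ G'0 G0 wc' ws' vw' vw) (le _ _ _ _ _ _ G0 G'0 wc ws vw vw').
rewrite ww' in vw'; move/uniform_cvgP : vw' => /(_ e e0) GA.
have GnA : G' (~` A) by apply: G0'; exact: withinT.
by have [t []] := filter_ex (filterI GA GnA).
Qed.
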